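(* Let $a>1$, $n\ge1$ and let $g\neq0$ be a fixed window function in $L^2(\mathbb{R})$. Then $$V_g(\phi_{g,n,a})(u,\eta)=e^{-\frac{iu\eta}{2}}\sum_{j=0}^nC_j(n,a)\,e^{\frac{i\eta}{2}\omega_j}A[g](u+\omega_j,\eta),\qquad\forall(u,\eta)\in\mathbb{R}^2,$$ where $\omega_j=1-\frac{2j}{n}$.
   Context: The short-time Fourier transform of $f\in L^2(\mathbb{R})$ with window $g\in L^2(\mathbb{R})$ is $V_g(f)(x,\omega)=\int_{\mathbb{R}}e^{-it\omega}\overline{g(t-x)}f(t)\,dt$. The approximating sequence of a function $\psi$ is $\phi_{\psi,n,a}(t)=\sum_{j=0}^nC_j(n,a)\,\psi\left(t+1-\frac{2j}{n}\right)$ with $C_j(n,a)=\binom{n}{j}\left(\frac{1+a}{2}\right)^{n-j}\left(\frac{1-a}{2}\right)^j$. The ambiguity function of $\varphi\in L^2(\mathbb{R})$ is $A[\varphi](u,\eta)=e^{\frac{iu\eta}{2}}V_\varphi(\varphi)(u,\eta)$. *)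

(* Defs.v *)
From HB Require Import structures.
From mathcomp Require Import all_boot all_order all_algebra.
From mathcomp Require Import complex.
From mathcomp Require Import all_classical all_reals all_analysis.
Set Implicit Arguments.
Unset Strict Implicit.
Unset Printing Implicit Defensive.
Import Order.TTheory GRing.Theory Num.Theory.
Import numFieldNormedType.Exports.
Local Open Scope classical_set_scope.
Local Open Scope ring_scope.
Local Open Scope complex_scope.

(* e^{i x} for real x *)
Definition expi (R : realType) (x : R) : R[i] := cos x +i* sin x.

(* Complex-valued functions on the line are integrated componentwise against
   Lebesgue measure.  As for Rintegral, this is a total operator; it is the
   usual integral when the real and imaginary parts of f are integrable. *)
Definition Cintegral (R : realType) (f : R -> R[i]) : R[i] :=
  Rintegral (@lebesgue_measure R) setT (fun t => complex.Re (f t))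
  +i* Rintegral (@lebesgue_measure R) setT (fun t => complex.Im (f t)).

(* f is a representative of a class in L^2(R; C); Normc.normc is the real-valued
   modulus on R[i]. *)
Definition L2C (R : realType) (f : R -> R[i]) : Prop :=
  [/\ measurable_fun setT (fun t => complex.Re (f t)),
      measurable_fun setT (fun t => complex.Im (f t)) &
      (\int[@lebesgue_measure R]_t ((Normc.normc (f t)) ^+ 2)%:E < +oo)%E].

(* f represents the zero class of L^2(R; C) *)
Definition L2C_zero (R : realType) (f : R -> R[i]) : Prop :=
  {ae @lebesgue_measure R, forall t, f t = 0}.

Definition STFT (R : realType) (g f : R -> R[i]) (x w : R) : R[i] :=
  Cintegral (fun t => expi (- (t * w)) * conjc (g (t - x)) * f t).

Definition approx_coef (R : realType) (n : nat) (a : R) (j : nat) : R :=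
  'C(n, j)%:R * ((1 + a) / 2) ^+ (n - j) * ((1 - a) / 2) ^+ j.

Definition approx_seq (R : realType) (psi : R -> R[i]) (n : nat) (a : R)
    (t : R) : R[i] :=
  \sum_(j < n.+1)
    (approx_coef n a j)%:C * psi (t + 1 - (2 * j%:R) / n%:R).

Definition ambiguity (R : realType) (phi : R -> R[i]) (u eta : R) : R[i] :=
  expi (u * eta / 2) * STFT phi phi u eta.

Definition omega (R : realType) (n j : nat) : R := 1 - (2 * j%:R) / n%:R.

(* Main.v *)
Require Import Defs.
From HB Require Import structures.
From mathcomp Require Import all_boot all_order all_algebra.
From mathcomp Require Import complex.
From mathcomp Require Import all_classical all_reals all_analysis.
From mathcomp Require Import measurable_realfun ring lra.
Import Order.TTheory GRing.Theory Num.Theory.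
Import numFieldNormedType.Exports.
Local Open Scope ring_scope.
Local Open Scope complex_scope.

(** The approximating sequence [approx_seq g n a] is a finite linear combination
    of the translates [t |-> g (t + omega_j)] with coefficients [approx_coef n a j].
    The short-time Fourier transform is linear in the signal ([STFT_lincomb]),
    and translating the signal by [c] translates the position variable by [c] and
    multiplies the transform by the phase [expi (eta * c)] ([STFT_shift]).  Hence
    the left-hand side is the combination of the numbers
    [expi (eta * omega_j) * STFT g g (u + omega_j) eta].  On the right-hand side,
    the phase built into the ambiguity function at [u + omega_j] combines with the
    explicit ones into the same factor, because
    [- u eta / 2 + eta omega_j / 2 + (u + omega_j) eta / 2 = eta omega_j].

    Two analytic facts support this.  Linearity of the integral requires
    integrability of [expi (- t eta) * conjc (g (t - u)) * f t] for [f] and [g]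
    square integrable; it follows from the domination of a product by a sum of
    squares ([L2C_mul_integrable]).  Covariance is the translation invariance of
    the Lebesgue measure ([lebesgue_measure_shift]), carried over to integrals of
    nonnegative, real-valued and complex-valued functions. *)

(** * Real and imaginary parts *)

Lemma complex_ReM {R : realType} (x y : R[i]) :
  complex.Re (x * y) =
  complex.Re x * complex.Re y - complex.Im x * complex.Im y.
Proof. by case: x y => [a b] [c d]. Qed.

Lemma complex_ImM {R : realType} (x y : R[i]) :
  complex.Im (x * y) =
  complex.Re x * complex.Im y + complex.Im x * complex.Re y.
Proof. by case: x y => [a b] [c d]. Qed.

Lemma complex_ReD {R : realType} (x y : R[i]) :
  complex.Re (x + y) = complex.Re x + complex.Re y.
Proof. by case: x y => [a b] [c d]. Qed.

Lemma complex_ImD {R : realType} (x y : R[i]) :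
  complex.Im (x + y) = complex.Im x + complex.Im y.
Proof. by case: x y => [a b] [c d]. Qed.

Lemma complex_ReJ {R : realType} (x : R[i]) :
  complex.Re (conjc x) = complex.Re x.
Proof. by case: x. Qed.

Lemma complex_ImJ {R : realType} (x : R[i]) :
  complex.Im (conjc x) = - complex.Im x.
Proof. by case: x. Qed.

Lemma sqr_normcE {R : realType} (x : R[i]) :
  Normc.normc x ^+ 2 = complex.Re x ^+ 2 + complex.Im x ^+ 2.
Proof. by case: x => a b /=; rewrite sqr_sqrtr// addr_ge0// sqr_ge0. Qed.

Lemma expiD {R : realType} (x y : R) : expi (x + y) = expi x * expi y.
Proof.
rewrite /expi cosD sinD; apply/eqP; rewrite eq_complex /=.
by apply/andP; split; apply/eqP; ring.
Qed.

Lemma normc_expi {R : realType} (x : R) : Normc.normc (expi x) = 1.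
Proof. by rewrite /= cos2Dsin2 sqrtr1. Qed.

(** * Translation invariance of the Lebesgue integral *)

Lemma measurable_shift {R : realType} (c : R) :
  measurable_fun setT ((fun x => x + c) : measurableTypeR R -> measurableTypeR R).
Proof. exact: measurable_funD. Qed.

(** Lebesgue measure is determined by its values on half-open intervals, and
    the preimage of such an interval by a translation is an interval of the
    same length. *)
Lemma lebesgue_measure_shift {R : realType} (c : R) (A : set R) :
  measurable A ->
  pushforward (@lebesgue_measure R)
    ((fun x => x + c) : _ -> measurableTypeR R) A = lebesgue_measure A.
Proof.
(* The pushforward is a measure only for a measurable map. *)
have ms := measurable_shift c.
move=> mA; apply/esym/lebesgue_measure_unique => //= _ [[a b]] _ <-.
rewrite /pushforward /=.
have -> : ((fun x : R => x + c) @^-1` `]a, b]%classic = `]a - c, b - c]%classic)%classic.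
  by apply/funext => x; rewrite /preimage /= /mkset !in_itv/= ltrBlDr lerBrDr.
rewrite !lebesgue_measure_itv/= !lte_fin ltrD2r.
by case: ifPn => // _; rewrite -!EFinB; congr EFin; ring.
Qed.

(** Change of variables along a translation: the image of the Lebesgue measure
    by the translation is the Lebesgue measure itself. *)
Lemma ge0_integral_shift {R : realType} (c : R) (f : R -> \bar R) :
  measurable_fun setT f -> (forall x, (0 <= f x)%E) ->
  (\int[@lebesgue_measure R]_x f (x + c)%R = \int[@lebesgue_measure R]_x f x)%E.
Proof.
have ms := measurable_shift c.
move=> mf f0.
transitivity (\int[pushforward (@lebesgue_measure R)
    ((fun x => (x + c)%R) : _ -> measurableTypeR R)]_x f x)%E; last first.
  by apply: eq_measure_integral => //= A mA _; exact: lebesgue_measure_shift.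
by rewrite ge0_integral_pushforward//; exact: measurable_shift.
Qed.

(** Measurability is enough here: the positive and negative parts are
    translated separately, and the equality survives when their integrals are
    infinite. *)
Lemma Rintegral_shift {R : realType} (c : R) (f : R -> R) :
  measurable_fun setT f ->
  Rintegral (@lebesgue_measure R) setT (fun x => f (x + c)) =
  Rintegral (@lebesgue_measure R) setT f.
Proof.
move=> mf; have mf' : measurable_fun setT (EFin \o f) by exact/measurable_EFinP.
rewrite /Rintegral; congr fine; rewrite [LHS]integralE [RHS]integralE; congr (_ - _)%E.
- rewrite -(ge0_integral_shift c _ (measurable_funepos mf') (funepos_ge0 _)).
  by apply: eq_integral => x _; rewrite !funeposE.
- rewrite -(ge0_integral_shift c _ (measurable_funeneg mf') (funeneg_ge0 _)).
  by apply: eq_integral => x _; rewrite !funenegE.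
Qed.

(** * Integration of complex-valued functions *)

Definition Cmeasurable {R : realType} (f : R -> R[i]) : Prop :=
  measurable_fun setT (fun t => complex.Re (f t)) /\
  measurable_fun setT (fun t => complex.Im (f t)).

Definition Cintegrable {R : realType} (f : R -> R[i]) : Prop :=
  (@lebesgue_measure R).-integrable setT (fun t => (complex.Re (f t))%:E) /\
  (@lebesgue_measure R).-integrable setT (fun t => (complex.Im (f t))%:E).

Lemma CmeasurableM {R : realType} (f h : R -> R[i]) :
  Cmeasurable f -> Cmeasurable h -> Cmeasurable (fun t => f t * h t).
Proof.
move=> [fr fi] [hr hi]; split.
- under eq_fun do rewrite complex_ReM.
  by apply: measurable_funB; exact: measurable_funM.
- under eq_fun do rewrite complex_ImM.
  by apply: measurable_funD; exact: measurable_funM.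
Qed.

Lemma Cmeasurable_conj {R : realType} (f : R -> R[i]) :
  Cmeasurable f -> Cmeasurable (fun t => conjc (f t)).
Proof.
move=> [fr fi]; split.
- by under eq_fun do rewrite complex_ReJ.
- by under eq_fun do rewrite complex_ImJ; exact: measurable_funN.
Qed.

Lemma Cmeasurable_shift {R : realType} (c : R) (f : R -> R[i]) :
  Cmeasurable f -> Cmeasurable (fun t => f (t + c)).
Proof.
by move=> [fr fi]; split; [apply: (measurableT_comp fr)|apply: (measurableT_comp fi)];
  exact: measurable_shift.
Qed.

Lemma Cmeasurable_expi {R : realType} (w : R) :
  Cmeasurable (fun t => expi (- (t * w))).
Proof.
have m : measurable_fun setT (fun t : R => - (t * w)).
  by apply: measurableT_comp => //; exact: measurable_funM.
split => /=.
- exact: (measurableT_comp (continuous_measurable_fun (@continuous_cos R)) m).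
- exact: (measurableT_comp (continuous_measurable_fun (@continuous_sin R)) m).
Qed.

Lemma Cintegral_shift {R : realType} (c : R) (f : R -> R[i]) :
  Cmeasurable f -> Cintegral (fun t => f (t + c)) = Cintegral f.
Proof.
move=> [fr fi]; rewrite /Cintegral.
rewrite (Rintegral_shift c (fun t => complex.Re (f t)))//.
by rewrite (Rintegral_shift c (fun t => complex.Im (f t))).
Qed.

Lemma Cintegrable_measurable {R : realType} (f : R -> R[i]) :
  Cintegrable f -> Cmeasurable f.
Proof.
by move=> [/integrableP[mr _] /integrableP[mi _]]; split; exact/measurable_EFinP.
Qed.

Lemma CintegrableD {R : realType} (f h : R -> R[i]) :
  Cintegrable f -> Cintegrable h -> Cintegrable (fun t => f t + h t).
Proof.
move=> [fr fi] [hr hi]; split.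
- by under eq_fun do rewrite complex_ReD EFinD; exact: integrableD.
- by under eq_fun do rewrite complex_ImD EFinD; exact: integrableD.
Qed.

Lemma CintegralD {R : realType} (f h : R -> R[i]) :
  Cintegrable f -> Cintegrable h ->
  Cintegral (fun t => f t + h t) = Cintegral f + Cintegral h.
Proof.
move=> [fr fi] [hr hi]; rewrite /Cintegral.
under eq_Rintegral do rewrite complex_ReD.
under [X in _ +i* X]eq_Rintegral do rewrite complex_ImD.
by rewrite !RintegralD.
Qed.

Lemma CintegrableZl {R : realType} (k : R[i]) (f : R -> R[i]) :
  Cintegrable f -> Cintegrable (fun t => k * f t).
Proof.
move=> [fr fi]; split.
- under eq_fun do rewrite complex_ReM EFinB !EFinM.
  by apply: integrableB => //; exact: integrableZl.
- under eq_fun do rewrite complex_ImM EFinD !EFinM.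
  by apply: integrableD => //; exact: integrableZl.
Qed.

Lemma CintegralZl {R : realType} (k : R[i]) (f : R -> R[i]) :
  Cintegrable f -> Cintegral (fun t => k * f t) = k * Cintegral f.
Proof.
move=> [fr fi]; rewrite /Cintegral.
have I (r : R) (h : R -> R) :
    (@lebesgue_measure R).-integrable setT (fun t => (h t)%:E) ->
    (@lebesgue_measure R).-integrable setT (EFin \o (fun t => r * h t)).
  move=> ih; rewrite (_ : EFin \o _ = fun t => (r%:E * (h t)%:E)%E)//.
  exact: integrableZl.
under eq_Rintegral do rewrite complex_ReM.
under [X in _ +i* X]eq_Rintegral do rewrite complex_ImM.
rewrite RintegralB//; [|exact: I..].
rewrite RintegralD//; [|exact: I..].
rewrite !RintegralZl//.
by apply/eqP; rewrite eq_complex complex_ReM complex_ImM/= !eqxx.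
Qed.

(** Integrability of the partial sums is carried along in the induction, since
    additivity of the integral requires it at each step. *)
Lemma Cintegral_sum {R : realType} (I : Type) (s : seq I) (f : I -> R -> R[i]) :
  (forall i, Cintegrable (f i)) ->
  Cintegral (fun t => \sum_(i <- s) f i t) = \sum_(i <- s) Cintegral (f i).
Proof.
move=> fi.
suff [] : Cintegrable (fun t => \sum_(i <- s) f i t) /\
  Cintegral (fun t => \sum_(i <- s) f i t) = \sum_(i <- s) Cintegral (f i) by [].
elim: s => [|i s [ih1 ih2]].
  under eq_fun do rewrite big_nil.
  rewrite big_nil; split; first by split; exact: integrable0.
  by rewrite /Cintegral /Rintegral /= integral0.
under eq_fun do rewrite big_cons.
rewrite big_cons; split; first exact: CintegrableD.
by rewrite CintegralD// ih2.
Qed.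

(** * Square-integrable functions *)

Lemma L2C_measurable {R : realType} (f : R -> R[i]) : L2C f -> Cmeasurable f.
Proof. by case. Qed.

Lemma L2C_integrable_sqr {R : realType} (f : R -> R[i]) : L2C f ->
  (@lebesgue_measure R).-integrable setT (fun t => (Normc.normc (f t) ^+ 2)%:E).
Proof.
move=> [fr fi foo]; apply/integrableP; split.
  apply/measurable_EFinP; under eq_fun do rewrite sqr_normcE.
  by apply: measurable_funD; exact: measurable_funX.
by under eq_integral => t _ do rewrite gee0_abs ?lee_fin ?sqr_ge0//.
Qed.

(** Square integrability only sees the modulus; this is how conjugation and
    multiplication by a unimodular factor are absorbed into the window. *)
Lemma L2C_eq_normc {R : realType} (f h : R -> R[i]) :
  L2C f -> Cmeasurable h ->
  (forall t, Normc.normc (h t) = Normc.normc (f t)) -> L2C h.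
Proof.
move=> [_ _ foo] [hr hi] fh; split => //.
by under eq_integral do rewrite fh.
Qed.

Lemma L2C_shift {R : realType} (c : R) (f : R -> R[i]) :
  L2C f -> L2C (fun t => f (t + c)).
Proof.
move=> f2; have [fr fi foo] := f2.
have [mr mi] := Cmeasurable_shift c _ (L2C_measurable _ f2); split => //.
rewrite (ge0_integral_shift c (fun t => (Normc.normc (f t) ^+ 2)%:E))//.
- by case/integrableP: (L2C_integrable_sqr _ f2).
- by move=> x; rewrite lee_fin sqr_ge0.
Qed.

(** A crude Cauchy-Schwarz bound. The right-hand side keeps an absolute value
    so that it has the form of a domination between integrands. *)
Lemma norm_dot_le_sqr {R : realType} (a b c d : R) :
  `|a * c + b * d| <= `|(a ^+ 2 + b ^+ 2) + (c ^+ 2 + d ^+ 2)|.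
Proof.
rewrite [leRHS]ger0_norm ?addr_ge0 ?sqr_ge0//.
have := (sqr_ge0 (a + c), sqr_ge0 (a - c), sqr_ge0 (b + d), sqr_ge0 (b - d)).
rewrite !expr2 => -[[[h1 h2] h3] h4].
have := (sqr_ge0 a, sqr_ge0 b, sqr_ge0 c, sqr_ge0 d).
rewrite !expr2 => -[[[k1 k2] k3] k4].
by rewrite ler_norml; apply/andP; split; nra.
Qed.

(** The real and imaginary parts of [f * h] are both dot products of
    [(Re f, Im f)] with a vector of the same length as [h], hence dominated by
    the integrable function [|f|^2 + |h|^2]. *)
Lemma L2C_mul_integrable {R : realType} (f h : R -> R[i]) :
  L2C f -> L2C h -> Cintegrable (fun t => f t * h t).
Proof.
move=> f2 h2.
have [mr mi] := CmeasurableM _ _ (L2C_measurable _ f2) (L2C_measurable _ h2).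
have := integrableD measurableT (L2C_integrable_sqr _ f2) (L2C_integrable_sqr _ h2).
move=> dom; split.
- apply: le_integrable dom => //; first exact/measurable_EFinP.
  move=> t _ /=; rewrite lee_fin !sqr_normcE complex_ReM.
  by rewrite -mulNr -[complex.Im (f t) ^+ 2]sqrrN norm_dot_le_sqr.
- apply: le_integrable dom => //; first exact/measurable_EFinP.
  move=> t _ /=; rewrite lee_fin !sqr_normcE complex_ImM.
  by rewrite [X in _ <= `|_ + X|]addrC norm_dot_le_sqr.
Qed.

(** * The short-time Fourier transform *)

(** A modulated, conjugated and translated window is still square integrable,
    so the integrand is a product of two square-integrable functions. *)
Lemma STFT_integrable {R : realType} (g f : R -> R[i]) (x w : R) :
  L2C g -> L2C f ->
  Cintegrable (fun t => expi (- (t * w)) * conjc (g (t - x)) * f t).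
Proof.
move=> g2 f2; apply: L2C_mul_integrable => //.
have gx2 := L2C_shift (- x) _ g2.
apply: (L2C_eq_normc _ _ gx2).
- apply: CmeasurableM; first exact: Cmeasurable_expi.
  exact: (Cmeasurable_conj _ (L2C_measurable _ gx2)).
- move=> t; rewrite Normc.normcM normc_expi mul1r.
  by case: (g _) => a b /=; rewrite sqrrN.
Qed.

Lemma STFT_lincomb {R : realType} (g : R -> R[i]) (n : nat)
    (k : 'I_n -> R[i]) (f : 'I_n -> R -> R[i]) (x w : R) :
  L2C g -> (forall j, L2C (f j)) ->
  STFT g (fun t => \sum_j k j * f j t) x w = \sum_j k j * STFT g (f j) x w.
Proof.
move=> g2 f2; rewrite /STFT.
under eq_fun do rewrite mulr_sumr.
under eq_fun do under eq_bigr do rewrite mulrCA.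
have I j := STFT_integrable _ _ x w g2 (f2 j).
rewrite Cintegral_sum; last by move=> j; exact: CintegrableZl.
by apply: eq_bigr => j _; rewrite CintegralZl.
Qed.

(** Covariance under translation of the signal: the substitution
    [t := t + c] moves the translation to the window and leaves behind a
    phase. *)
Lemma STFT_shift {R : realType} (g f : R -> R[i]) (c x w : R) :
  L2C g -> L2C f ->
  STFT g (fun t => f (t + c)) x w = expi (w * c) * STFT g f (x + c) w.
Proof.
move=> g2 f2; have iF := STFT_integrable _ _ (x + c) w g2 f2.
rewrite /STFT -CintegralZl//.
set F := (F in _ = Cintegral F); rewrite -(Cintegral_shift c F).
  congr Cintegral; apply/funext => t; rewrite /F !mulrA -expiD.
  by congr (expi _ * conjc (g _) * _); ring.
exact: (Cintegrable_measurable _ (CintegrableZl _ _ iF)).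
Qed.

Theorem theorem8p6 (R : realType) (a : R) (n : nat) (g : R -> R[i])
    (a_gt1 : 1 < a) (n_ge1 : (1 <= n)%N)
    (g_L2 : L2C g) (g_neq0 : ~ L2C_zero g) :
  forall u eta : R,
    STFT g (approx_seq g n a) u eta =
    expi (- (u * eta / 2)) *
      \sum_(j < n.+1)
        (approx_coef n a j)%:C * expi (eta / 2 * omega R n j) *
          ambiguity g (u + omega R n j) eta.
Proof.
move=> u eta.
rewrite (_ : approx_seq g n a = fun t => \sum_(j < n.+1)
    (approx_coef n a j)%:C * g (t + omega R n j)); last first.
  by apply/funext => t; apply: eq_bigr => j _; rewrite /omega addrA.
rewrite STFT_lincomb//; last by move=> j; exact: L2C_shift.
rewrite mulr_sumr; apply: eq_bigr => j _.
rewrite STFT_shift// /ambiguity !mulrA.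
(* Bring the real coefficient to the front and the transform to the back;
   only the phases are then to be compared. *)
rewrite [expi (- _) * _]mulrC -!mulrA !mulrA; congr (_ * _).
rewrite -!mulrA; congr (_ * _); rewrite -!expiD; congr expi.
by field.
Qed.
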